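(* Let $X$ be an irreducible projective variety over $\mathbb{C}$ of dimension $m$ and let $\mathcal{L}$ be a globally generated and big line bundle over $X$. Suppose that $(X,\mathcal{L})$ admits a family $\{\Delta_{\mathsf{s}}\mid\mathsf{s}\text{ is a seed}\}$ of Newton--Okounkov bodies in $\mathbb{R}^J=\mathbb{R}^m$ containing the origin, indexed by the seeds of a cluster algebra and arising from a family of finitely generated saturated semigroups endowed with a tropical cluster structure. Assume that there exists a polytope $\Delta_{\mathsf{s}_0}$ in this family satisfying: (1) (Fixed point) there exists a point $\mathbf{u}_0\in\mathrm{Int}(\Delta_{\mathsf{s}_0})\cap\mathbb{Q}^m$ that is fixed under all iterated tropicalized cluster mutations. Suppose further that there exist a sequence $(\mathsf{s}_\ell)_{\ell\in\mathbb{N}}$ of seeds and indices $(r,s)\in J_{\mathrm{uf}}\times J$ such that (2) (Multiplicity) the sequence $(\varepsilon^\ell_{r,s})_{\ell\in\mathbb{N}}$ of the $(r,s)$-entries of the extended exchange matrices of the seeds $\mathsf{s}_\ell$ diverges to $-\infty$ as $\ell\to\infty$; and (3) (Non-negativity) for every seed $\mathsf{s}$, the Newton--Okounkov polytope $\Delta_{\mathsf{s}}$ is contained in the half-space $\{\mathbf{u}\in\mathbb{R}^m\mid u_s\ge0\}$. Then the set $\{[\Delta_{\mathsf{s}}]\mid\mathsf{s}\text{ is a seed}\}$ of equivalence classes under integral affine transformations is infinite.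
   Context: **Newton--Okounkov bodies.** Fix a total order on $\mathbb{Z}^m$ compatible with addition, a valuation $v:\mathbb{C}(X)\setminus\{0\}\to\mathbb{Z}^m$ with one-dimensional leaves, and a nonzero $h\in H^0(X,\mathcal{L})$. The value semigroup is $S(X,\mathcal{L},v,h)=\bigcup_{k\ge1}\{(k,v(f/h^k))\mid f\in H^0(X,\mathcal{L}^{\otimes k})\setminus\{0\}\}\subseteq\mathbb{R}_{\ge0}\times\mathbb{R}^m$, and the Newton--Okounkov body $\Delta(X,\mathcal{L},v,h)$ is the closed convex hull of $\bigcup_{k\ge1}\{x/k\mid(k,x)\in S(X,\mathcal{L},v,h)\}$. A Newton--Okounkov body of $(X,\mathcal{L})$ is one of this form. **Seeds.** $J=J_{\mathrm{uf}}\sqcup J_{\mathrm{fz}}$ with $|J|=m$. A seed consists of cluster variables indexed by $J$ and an extended exchange matrix $\varepsilon=(\varepsilon_{r,s})_{r\in J_{\mathrm{uf}},s\in J}$ with integer entries and skew-symmetrizable principal part; all seeds are obtained from an initial one by iterated mutations at $k\in J_{\mathrm{uf}}$, which change the matrix by $\varepsilon'_{r,s}=-\varepsilon_{r,s}$ if $r=k$ or $s=k$, and $\varepsilon'_{r,s}=\varepsilon_{r,s}+\mathrm{sgn}(\varepsilon_{k,s})[\varepsilon_{r,k}\varepsilon_{k,s}]_+$ otherwise, where $[a]_+=\max\{a,0\}$. **Tropicalized cluster mutation.** For a seed with matrix $\varepsilon$ and $k\in J_{\mathrm{uf}}$, $\mu_k^T:\mathbb{R}^J\to\mathbb{R}^J$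 maps $(u_j)$ to $(u'_j)$, $u'_k=-u_k$ and, for $j\ne k$, $u'_j=u_j+[\varepsilon_{k,j}]_+u_k$ if $u_k\ge0$, $u'_j=u_j+[-\varepsilon_{k,j}]_+u_k$ if $u_k\le0$; $\widehat\mu_k^T(r,\mathbf{u})=(r,\mu_k^T(\mathbf{u}))$ on $\mathbb{R}_{\ge0}\times\mathbb{R}^J$. A family of semigroups $S_{\mathsf{s}}\subseteq\mathbb{R}_{\ge0}\times\mathbb{R}^J$ indexed by seeds has a tropical cluster structure if $S_{\mathsf{s}'}=\widehat\mu_k^T(S_{\mathsf{s}})$ whenever $\mathsf{s}'=\mu_k(\mathsf{s})$. **Equivalence.** Two polytopes in $\mathbb{R}^m$ are equivalent if one is the image of the other under an integral affine transformation $\mathbf{u}\mapsto A\mathbf{u}+\mathbf{u}_1$ with $A\in\mathrm{GL}(m,\mathbb{Z})$, $\mathbf{u}_1\in\mathbb{Z}^m$; $[\Delta]$ denotes the class. *)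

(* Defs.v *)
From HB Require Import structures.
From mathcomp Require Import all_boot all_order all_algebra.
From mathcomp.classical Require Import boolp classical_sets functions cardinality.
From mathcomp Require Import reals topology normedtype convex.
From mathcomp.real_closed Require Import complex.
(* The notations of mpoly clash with those of mathcomp-analysis. *)
From mathcomp Require Import -(notations) mpoly.

Set Implicit Arguments.
Unset Strict Implicit.
Unset Printing Implicit Defensive.

Import Order.TTheory GRing.Theory Num.Theory numFieldNormedType.Exports.

Local Open Scope classical_set_scope.
Local Open Scope ring_scope.

(* A point of P^n is given by its nonzero representatives in C^(n+1), so a
   subset of P^n is its punctured affine cone. *)

Definition homog (A : comNzRingType) (n d : nat) (F : mpoly n A) : Prop :=
  F \is ishomog1 d mdeg.

Definition zariski_closed (R : realType) (n : nat)
    (Z : set 'rV[R[i]]_n.+1) : Prop :=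
  exists E : set (mpoly n.+1 R[i]),
    (forall F, E F -> exists d, homog d F) /\
    Z = [set p | p != 0 /\ forall F, E F -> meval (p 0) F = 0].

Definition zariski_irreducible (R : realType) (n : nat)
    (Z : set 'rV[R[i]]_n.+1) : Prop :=
  [/\ zariski_closed Z, Z !=set0 &
      forall Z1 Z2, zariski_closed Z1 -> zariski_closed Z2 ->
        Z `<=` Z1 `|` Z2 -> Z `<=` Z1 \/ Z `<=` Z2].

(* An irreducible closed subset of P^n together with its function field C(X).
   The field is not built but characterized: [gen] is a homogeneous coordinate
   vector of the generic point (for instance gen i = X_i / X_j, where X_j does
   not vanish identically on X), so that [gen_frac] says that the elements of
   C(X) are the fractions F / G of forms of the same degree with G nonzero on
   X, and [gen_zero] says that such a fraction is 0 exactly when F vanishes on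
   X.  This determines C(X) up to isomorphism of extensions of C. *)
Record projVariety (R : realType) := ProjVariety {
  ambient : nat;
  carrier : set 'rV[R[i]]_ambient.+1;
  carrier_irreducible : zariski_irreducible carrier;
  funField : fieldType;
  scal : {rmorphism R[i] -> funField};
  gen : 'I_ambient.+1 -> funField;
  gen_zero : forall d (F : mpoly ambient.+1 R[i]), homog d F ->
    (mmap scal gen F = 0 <->
     forall p, carrier p -> meval (p 0) F = 0);
  gen_frac : forall a : funField,
    exists d (F G : mpoly ambient.+1 R[i]),
      [/\ homog d F, homog d G, mmap scal gen G != 0 &
          a = mmap scal gen F / mmap scal gen G]
}.

Arguments carrier {R} p.
Arguments gen {R} p.

(* Krull dimension of the Zariski topology. *)
Definition irreducible_chain (R : realType) (X : projVariety R) (l : nat) : Prop :=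
  exists Z : nat -> set 'rV[R[i]]_(ambient X).+1,
    (forall i, (i <= l)%N -> zariski_irreducible (Z i) /\ Z i `<=` carrier X) /\
    (forall i, (i < l)%N -> Z i `<` Z i.+1).

Definition has_dim (R : realType) (X : projVariety R) (m : nat) : Prop :=
  irreducible_chain X m /\ forall l, irreducible_chain X l -> (l <= m)%N.

Definition local_ring (R : realType) (X : projVariety R)
    (p : 'rV[R[i]]_(ambient X).+1) : set (funField X) :=
  [set a | exists d (F G : mpoly (ambient X).+1 R[i]),
     [/\ homog d F, homog d G, meval (p 0) G != 0 &
         a = mmap (scal X) (gen X) F / mmap (scal X) (gen X) G]].

Definition regular_on (R : realType) (X : projVariety R)
    (U : set 'rV[R[i]]_(ambient X).+1) : set (funField X) :=
  [set a | forall p, U p -> local_ring p a].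

Definition zariski_open_in (R : realType) (X : projVariety R)
    (U : set 'rV[R[i]]_(ambient X).+1) : Prop :=
  exists2 Z, zariski_closed Z & U = carrier X `\` Z.

(* A line bundle given by transition functions [trans i j] in O*(U_i `&` U_j)
   on a finite trivializing open cover.  Since X is irreducible, functions on
   the U_i are elements of C(X); [trans j i] is the inverse of [trans i j] by
   the cocycle condition, so regularity of all [trans i j] makes them units. *)
Record lineBundle (R : realType) (X : projVariety R) := LineBundle {
  lb_size : nat;
  chart : 'I_lb_size -> set 'rV[R[i]]_(ambient X).+1;
  trans : 'I_lb_size -> 'I_lb_size -> funField X;
  chart_open : forall i, zariski_open_in (chart i) /\ chart i !=set0;
  chart_cover : forall p, carrier X p -> exists i, chart i p;
  trans_regular : forall i j, regular_on (chart i `&` chart j) (trans i j);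
  trans_neq0 : forall i j, trans i j != 0;
  trans_cocycle : forall i j l, trans i l = trans i j * trans j l
}.

Arguments chart {R X} _.
Arguments trans {R X} _.

(* A rational section, through its expressions in the charts. *)
Definition preSection (R : realType) (X : projVariety R) (L : lineBundle X) :=
  'I_(lb_size L) -> funField X.

(* H^0(X, L^k): the transition functions of L^k are the k-th powers. *)
Definition H0 (R : realType) (X : projVariety R) (L : lineBundle X) (k : nat) :
    set (preSection L) :=
  [set f | (forall i, regular_on (chart L i) (f i)) /\
           (forall i j, f i = trans L i j ^+ k * f j)].

Definition nonzero_section (R : realType) (X : projVariety R)
    (L : lineBundle X) (f : preSection L) : Prop := exists i, f i != 0.

Definition globally_generated (R : realType) (X : projVariety R)
    (L : lineBundle X) : Prop :=
  forall p, carrier X p ->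
    exists f i, [/\ H0 1 f, chart L i p, f i != 0 & local_ring p (f i)^-1].

Definition lin_indep_sections (R : realType) (X : projVariety R)
    (L : lineBundle X) (N : nat) (f : 'I_N -> preSection L) : Prop :=
  forall a : 'I_N -> R[i],
    (forall i, \sum_(j < N) scal X (a j) * f j i = 0) -> forall j, a j = 0.

(* For X of dimension m: h^0(X, L^k) >= c k^m for some c > 0 and all large k. *)
Definition big_bundle (R : realType) (X : projVariety R) (m : nat)
    (L : lineBundle X) : Prop :=
  exists (c : R) (k0 : nat), 0 < c /\
    forall k, (k0 <= k)%N ->
      exists (N : nat) (f : 'I_N -> preSection L),
        [/\ c * k%:R ^+ m <= N%:R, forall j, H0 k (f j) & lin_indep_sections f].

Definition group_order (m : nat) (le : rel 'rV[int]_m) : Prop :=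
  [/\ reflexive le, antisymmetric le, transitive le, total le &
      forall a b c, le a b -> le (a + c) (b + c)].

(* The value of v at 0 is irrelevant. *)
Definition is_valuation (R : realType) (X : projVariety R) (m : nat)
    (le : rel 'rV[int]_m) (v : funField X -> 'rV[int]_m) : Prop :=
  [/\ forall f g, f != 0 -> g != 0 -> v (f * g) = v f + v g,
      forall f g, f != 0 -> g != 0 -> f + g != 0 ->
        le (v f) (v g) -> le (v f) (v (f + g)) &
      forall (c : R[i]) f, c != 0 -> f != 0 -> v (scal X c * f) = v f].

(* For every a, the complex vector space {f | f = 0 or v f >= a} modulo
   {f | f = 0 or v f > a} has dimension at most 1. *)
Definition one_dim_leaves (R : realType) (X : projVariety R) (m : nat)
    (le : rel 'rV[int]_m) (v : funField X -> 'rV[int]_m) : Prop :=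
  let ge_part a := [set f | f = 0 \/ le a (v f)] in
  let gt_part a := [set f | f = 0 \/ (le a (v f) /\ v f <> a)] in
  forall a f g, ge_part a f -> ge_part a g ->
    exists c d : R[i], (c != 0 \/ d != 0) /\
      gt_part a (scal X c * f + scal X d * g).

Definition int_vec (R : realType) (m : nat) (a : 'rV[int]_m) : 'rV[R]_m :=
  map_mx intr a.

(* f / h^k is f i / h i ^+ k, which does not depend on the chart i. *)
Definition value_semigroup (R : realType) (X : projVariety R)
    (L : lineBundle X) (m : nat) (v : funField X -> 'rV[int]_m)
    (h : preSection L) : set (R * 'rV[R]_m) :=
  [set z | exists k (f : preSection L) i,
     [/\ (0 < k)%N, H0 k f, nonzero_section f &
         z = (k%:R, int_vec R (v (f i / h i ^+ k)))]].

Definition closed_convex_hull (R : realType) (m : nat) (A : set 'rV[R]_m) :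
    set 'rV[R]_m :=
  smallest (fun B : set 'rV[R]_m => convex_set B /\ closed B) A.

Definition newton_okounkov_body (R : realType) (X : projVariety R)
    (L : lineBundle X) (m : nat) (v : funField X -> 'rV[int]_m)
    (h : preSection L) : set 'rV[R]_m :=
  closed_convex_hull
    [set y | exists (k : nat) (x : 'rV[R]_m),
       [/\ (0 < k)%N, value_semigroup v h (k%:R, x) & y = k%:R^-1 *: x]].

(* [S] and [Delta] are the value semigroup and the Newton--Okounkov body of
   (X, L) for one and the same choice of an order, a valuation and a section. *)
Definition is_newton_okounkov (R : realType) (X : projVariety R)
    (L : lineBundle X) (m : nat) (S : set (R * 'rV[R]_m))
    (Delta : set 'rV[R]_m) : Prop :=
  exists (le : rel 'rV[int]_m) (v : funField X -> 'rV[int]_m)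
         (h : preSection L),
    [/\ group_order le, is_valuation le v, one_dim_leaves le v,
        H0 1 h /\ nonzero_section h &
        S = value_semigroup v h /\ Delta = newton_okounkov_body v h].

(* Finite generation as a semigroup, without a neutral element. *)
Definition finitely_generated (R : realType) (m : nat)
    (S : set (R * 'rV[R]_m)) : Prop :=
  exists (N : nat) (g : 'I_N -> R * 'rV[R]_m),
    S = [set z | exists c : 'I_N -> nat,
           (exists i, (0 < c i)%N) /\ z = \sum_(i < N) g i *+ c i].

(* Saturated in the lattice Z x Z^m. *)
Definition saturated (R : realType) (m : nat) (S : set (R * 'rV[R]_m)) : Prop :=
  forall (k : int) (a : 'rV[int]_m) (n : nat), (0 < n)%N ->
    S ((k%:~R, int_vec R a) *+ n) -> S (k%:~R, int_vec R a).

(* J = 'I_m, and [uf] is the subset of unfrozen indices. *)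
Definition Juf (m : nat) (uf : {set 'I_m}) := {k : 'I_m | k \in uf}.

Definition pos_part (a : int) : int := Num.max a 0.

Record seed (m : nat) (uf : {set 'I_m}) (K : fieldType) := Seed {
  cluster : 'I_m -> K;
  exch : Juf uf -> 'I_m -> int
}.

Definition mutate_exch (m : nat) (uf : {set 'I_m}) (k : Juf uf)
    (eps : Juf uf -> 'I_m -> int) : Juf uf -> 'I_m -> int :=
  fun r s =>
    if (r == k) || (s == val k) then - eps r s
    else eps r s + Num.sg (eps k s) * pos_part (eps r (val k) * eps k s).

Definition mutate_cluster (m : nat) (uf : {set 'I_m}) (K : fieldType)
    (k : Juf uf) (t : seed uf K) : 'I_m -> K :=
  fun j =>
    if j == val k then
      (\prod_i cluster t i ^+ `|pos_part (exch t k i)|%N +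
       \prod_i cluster t i ^+ `|pos_part (- exch t k i)|%N) / cluster t j
    else cluster t j.

Definition mutate (m : nat) (uf : {set 'I_m}) (K : fieldType) (k : Juf uf)
    (t : seed uf K) : seed uf K :=
  Seed (mutate_cluster k t) (mutate_exch k (exch t)).

(* [K] is an ambient field, containing the complex numbers through [iota]; the
   cluster is a free generating set, so that K is C(z_1, ..., z_m), and the
   principal part of the exchange matrix is skew-symmetrizable. *)
Definition initial_seed (R : realType) (m : nat) (uf : {set 'I_m})
    (K : fieldType) (iota : {rmorphism R[i] -> K}) (t : seed uf K) : Prop :=
  [/\ forall P : mpoly m R[i],
        mmap iota (cluster t) P = 0 -> P = 0,
      forall a : K, exists P Q : mpoly m R[i],
        mmap iota (cluster t) Q != 0 /\
        a = mmap iota (cluster t) P / mmap iota (cluster t) Q &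
      exists d : Juf uf -> int, (forall r, 0 < d r) /\
        forall r s, d r * exch t r (val s) = - (d s * exch t s (val r))].

Inductive seeds (m : nat) (uf : {set 'I_m}) (K : fieldType) (t0 : seed uf K) :
    seed uf K -> Prop :=
| seeds_init : seeds t0 t0
| seeds_mutate t k : seeds t0 t -> seeds t0 (mutate k t).

Definition trop_mut (R : realType) (m : nat) (uf : {set 'I_m})
    (eps : Juf uf -> 'I_m -> int) (k : Juf uf) (u : 'rV[R]_m) : 'rV[R]_m :=
  \row_j
    if j == val k then - u 0 j
    else if 0 <= u 0 (val k)
    then u 0 j + (pos_part (eps k j))%:~R * u 0 (val k)
    else u 0 j + (pos_part (- eps k j))%:~R * u 0 (val k).

Definition trop_mut_hat (R : realType) (m : nat) (uf : {set 'I_m})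
    (eps : Juf uf -> 'I_m -> int) (k : Juf uf) (z : R * 'rV[R]_m) :
    R * 'rV[R]_m := (z.1, trop_mut eps k z.2).

(* The composite of the tropicalized mutations in the directions [ks], starting
   at the seed [t]; each one uses the exchange matrix of the current seed. *)
Fixpoint trop_mut_seq (R : realType) (m : nat) (uf : {set 'I_m})
    (K : fieldType) (t : seed uf K) (ks : seq (Juf uf)) (u : 'rV[R]_m) :
    'rV[R]_m :=
  if ks is k :: ks' then trop_mut_seq (mutate k t) ks' (trop_mut (exch t) k u)
  else u.

Definition tropical_cluster_structure (R : realType) (m : nat)
    (uf : {set 'I_m}) (K : fieldType) (t0 : seed uf K)
    (S : seed uf K -> set (R * 'rV[R]_m)) : Prop :=
  forall t k, seeds t0 t ->
    S (mutate k t) = [set trop_mut_hat (exch t) k z | z in S t].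

(* Vectors are rows, so u |-> A u + b is written with the transpose of A, which
   again ranges over GL(m, Z). *)
Definition affine_class (R : realType) (m : nat) (D : set 'rV[R]_m) :
    set (set 'rV[R]_m) :=
  [set D' | exists (A : 'M[int]_m) (b : 'rV[int]_m),
     A \in unitmx /\
     D' = [set u *m map_mx intr A + int_vec R b | u in D]].

(* Main.v *)
Require Import Defs.
From HB Require Import structures.
From mathcomp Require Import all_boot all_order all_algebra.
From mathcomp.classical Require Import boolp classical_sets functions cardinality.
From mathcomp Require Import reals topology normedtype convex.
From mathcomp.real_closed Require Import complex.
From mathcomp Require Import interval_inference lra ring zify.

Set Implicit Arguments.
Unset Strict Implicit.
Unset Printing Implicit Defensive.

Import Order.TTheory GRing.Theory Num.Theory numFieldNormedType.Exports.

Local Open Scope classical_set_scope.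
Local Open Scope ring_scope.

(** Since [u0] is fixed, its unfrozen coordinates vanish, so every tropical
mutation fixes it.  The slopes [x / k] of an additive semigroup [S_t] are stable
under rational convex combinations, so [Delta_t] is just their closure;
tropical mutations are homeomorphisms commuting with positive scalings, hence
they carry [Delta_t] onto the body of the mutated seed, and [u0] is interior to
all of them.  If [exch t r s = - N], nonnegativity of [u_s] on the mutated body
reads [u_s + N u_r >= 0] on [Delta_t].  This affine form has the same value at
[u0] for all [N], whereas its gradient grows with [N].  In one affine class the
form and [u0] pull back to a fixed body; there [u0] becomes one of finitely many
interior points of bounded denominator, around each of which the gradients of
nonnegative forms with a prescribed value are bounded.  So each class only
allows boundedly many [N]. *)

(** * Closed convex hulls and rational combinations *)

Lemma row_continuous (R : realType) (T : topologicalType) (n : nat)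
    (f : T -> 'rV[R]_n) :
  (forall j, continuous (fun x => f x 0 j)) -> continuous f.
Proof.
move=> cf x; apply/cvg_ballP => e e0; near=> y.
rewrite /ball /=; split=> // i j; rewrite (ord1 i); move: j.
by near: y; apply: filter_forall => j; have /cvg_ballP := cf j x; apply.
Unshelve. all: by end_near. Qed.

(** The parameters in [(0, 1)] whose combination leaves the closed set [D] form an open set, which
    would contain a rational number if it were nonempty. *)
Lemma rational_combinations_convex (R : realType) (m : nat)
    (D : set 'rV[R]_m) :
  closed D ->
  (forall (q : rat) x y, 0 < q -> q < 1 -> D x -> D y ->
     D (ratr q *: x + (1 - ratr q) *: y)) ->
  convex_set D.
Proof.
move=> Dcl Drat; apply/convex_setW => x y /set_mem Dx /set_mem Dy k k0 k1.
apply/mem_set; pose f (t : R) := t *: (x : 'rV[R]_m) + (1 - t) *: y.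
change (D (f k%:num)); apply: contrapT => Dk.
have cf : continuous f.
  move=> t; apply: cvgD; apply: cvgZr_tmp; first exact: cvg_id.
  by apply: cvgB; [exact: cvg_cst|exact: cvg_id].
have oU : open ((f @^-1` ~` D) `&` `]0, 1[%classic).
  apply: openI; last exact: interval_open.
  by apply: open_comp; [move=> *; exact: cf|exact: closed_openC].
have [|t [[Dt tin] [q _ qE]]] := @dense_rat R _ _ oU.
  by exists k%:num; split => //=; rewrite in_itv /= k0 k1.
move: tin; rewrite /= in_itv /= => /andP[q0 q1]; apply: Dt.
rewrite -qE in q0 q1 *; apply: Drat => //; first by rewrite ltr0q in q0.
by move: q1; rewrite -(rmorph1 (@ratr R)) ltr_rat.
Qed.

Lemma scale_add_continuous (R : realType) (V : normedModType R) (a : R)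
    (z : V) :
  continuous (fun w : V => a *: w + z).
Proof.
by move=> w; apply: cvgD; [apply: cvgZl_tmp; exact: cvg_id|exact: cvg_cst].
Qed.

(** Rational combinations pass to the closure one argument at a time: first with the second point in
    [D], then with the first point fixed in the closure. *)
Lemma closure_rational_combinations (R : realType) (m : nat)
    (D : set 'rV[R]_m) :
  (forall (q : rat) x y, 0 < q -> q < 1 -> D x -> D y ->
     D (ratr q *: x + (1 - ratr q) *: y)) ->
  closed_convex_hull D = closure D.
Proof.
move=> Drat; rewrite /closed_convex_hull; apply/seteqP; split.
  apply: smallest_sub; last exact: subset_closure.
  split; last exact: closed_closure.
  apply: rational_combinations_convex; first exact: closed_closure.
  move=> q x y q0 q1 Dx Dy.
  have step1 z : D z ->
      closure D `<=` [set w | closure D (ratr q *: w + (1 - ratr q) *: z)].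
    move=> Dz; rewrite [X in X `<=` _]closureE; apply: smallest_sub.
      apply: (@preimage_closed _ _ (fun w : 'rV[R]_m =>
        ratr q *: w + (1 - ratr q) *: z)); last exact: closed_closure.
      by move=> w _; exact: scale_add_continuous.
    by move=> w Dw; apply: subset_closure; exact: Drat.
  have: closure D `<=` [set z | closure D (ratr q *: x + (1 - ratr q) *: z)].
    rewrite [X in X `<=` _]closureE; apply: smallest_sub.
      under eq_set do rewrite addrC.
      apply: (@preimage_closed _ _ (fun z : 'rV[R]_m =>
        (1 - ratr q) *: z + ratr q *: x)); last exact: closed_closure.
      by move=> w _; exact: scale_add_continuous.
    by move=> z Dz; apply: step1.
  exact.
rewrite closureE; apply: smallest_sub.
  by apply: closed_bigI => B [[_ ?] _].
exact: sub_gen_smallest.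
Qed.

(* [newton_okounkov_body v h] is the closed convex hull of the slopes of
   [value_semigroup v h], by conversion. *)
Definition slopes (R : realType) (m : nat) (S : set (R * 'rV[R]_m)) :
    set 'rV[R]_m :=
  [set y | exists (k : nat) (x : 'rV[R]_m),
     [/\ (0 < k)%N, S (k%:R, x) & y = k%:R^-1 *: x]].

(** * Slopes of a finitely generated semigroup *)

Lemma finitely_generatedD (R : realType) (m : nat) (S : set (R * 'rV[R]_m)) :
  finitely_generated S -> forall z w, S z -> S w -> S (z + w).
Proof.
move=> [N [g ->]] _ _ [c [[i ci] ->]] [c' [_ ->]].
exists (fun i => c i + c' i)%N; split; first by exists i; rewrite addn_gt0 ci.
by rewrite -big_split; apply: eq_bigr => j _; rewrite mulrnDr.
Qed.

Lemma slopes_rational_combinations (R : realType) (m : nat)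
    (S : set (R * 'rV[R]_m)) :
  (forall z w, S z -> S w -> S (z + w)) ->
  forall (q : rat) x y, 0 < q -> q < 1 -> slopes S x -> slopes S y ->
    slopes S (ratr q *: x + (1 - ratr q) *: y).
Proof.
move=> SD q _ _ q0 q1 [k [x [k0 Sx ->]]] [l [y [l0 Sy ->]]].
have SM z n : (0 < n)%N -> S z -> S (z *+ n).
  case: n => // n _ Sz; elim: n => // n IH.
  by rewrite mulrSr; exact: SD.
have [a [b [a0 b0 qE]]] : exists a b : nat,
    [/\ (0 < a)%N, (0 < b)%N & q = a%:R / (a + b)%:R].
  exists `|numq q|%N, (`|denq q| - `|numq q|)%N.
  have n0 : 0 < numq q by rewrite numq_gt0.
  have nd : numq q < denq q.
    rewrite -(ltr_int rat) numqE -[ltRHS]mul1r ltr_pM2r //.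
    by rewrite ltr0z denq_gt0.
  have ndn : (`|numq q| < `|denq q|)%N by have := denq_gt0 q; lia.
  split; [lia|by rewrite subn_gt0|].
  by rewrite subnKC ?(ltnW ndn) // !natr_absz !ger0_norm ?ltW // divq_num_den.
have kR : k%:R != 0 :> R by rewrite pnatr_eq0 -lt0n.
have lR : l%:R != 0 :> R by rewrite pnatr_eq0 -lt0n.
have abR : a%:R + b%:R != 0 :> R by rewrite -natrD pnatr_eq0 -lt0n addn_gt0 a0.
(* The multiples [a * l] and [b * k] bring the two elements to heights proportional to [a] and [b],
   so their slopes are averaged with weights [a / (a + b)] and [b / (a + b)]. *)
exists ((a + b) * (k * l))%N, (x *+ (a * l) + y *+ (b * k)); split.
- by rewrite !muln_gt0 addn_gt0 a0 k0 l0.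
- have := SD _ _ (SM _ (a * l)%N _ Sx) (SM _ (b * k)%N _ Sy).
  rewrite !muln_gt0 a0 l0 b0 k0 => /(_ isT isT); congr (S _).
  rewrite [LHS]surjective_pairing; congr pair.
    rewrite raddfD !raddfMn /= -!mulrnA -mulrnDr.
    by rewrite mulnDl (mulnCA k) (mulnCA l) (mulnC l).
  by rewrite raddfD !raddfMn.
- rewrite qE fmorph_div /= !ratr_nat natrD.
  rewrite -(scaler_nat _ x) -(scaler_nat _ y) scalerDr !scalerA !natrM natrD.
  congr (_ *: _ + _ *: _).
    by field; rewrite kR lR abR.
  by field; rewrite kR lR abR.
Qed.

(** A slope is a combination of generators divided by its height. Generators have height at least 1,
    so a bound [M] for all their coordinates makes the numerator at most [M] times the height. *)
Lemma slopes_bounded (R : realType) (m : nat) (S : set (R * 'rV[R]_m)) :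
  finitely_generated S -> (forall z, S z -> 1 <= z.1) ->
  exists M, forall y, closure (slopes S) y -> forall j, `|y 0 j| <= M.
Proof.
move=> [N [g SE]] S1.
have g1 i : 1 <= (g i).1.
  apply: S1; rewrite SE; exists (fun j => (j == i) : nat).
  split; first by exists i; rewrite eqxx.
  rewrite (bigD1 i) //= eqxx mulr1n big1 ?addr0 // => j /negbTE ->.
  by rewrite mulr0n.
set M := \sum_i \sum_j `|(g i).2 0 j|; exists M => y Sy j.
suff: closure (slopes S) `<=` [set y : 'rV[R]_m | `|y 0 j| <= M] by apply.
rewrite closureE; apply: smallest_sub.
  apply: (@preimage_closed _ _ (fun y : 'rV[R]_m => `|y 0 j|)
    [set t | t <= M]); last exact: closed_le.
  move=> w _.
  apply: (@continuous_comp _ _ _ (fun y : 'rV[R]_m => y 0 j) Num.norm).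
    exact: coord_continuous.
  exact: norm_continuous.
move=> _ [k [x [k0 + ->]]]; rewrite SE => -[c [_ zE]] /=.
have kE : k%:R = \sum_i (g i).1 *+ c i.
  have /(congr1 fst) /= -> := zE.
  by rewrite raddf_sum; apply: eq_bigr => i _; rewrite raddfMn.
have xE : x = \sum_i (g i).2 *+ c i.
  have /(congr1 snd) /= -> := zE.
  by rewrite raddf_sum; apply: eq_bigr => i _; rewrite raddfMn.
have kR : 0 < k%:R :> R by rewrite ltr0n.
rewrite /= mxE normrM normfV (gtr0_norm kR) ler_pdivrMl // kE xE summxE.
rewrite mulr_suml; apply: le_trans (ler_norm_sum _ _ _) _.
apply: ler_sum => i _.
rewrite mulmxnE normrMn mulrnAl.
have gM : `|(g i).2 0 j| <= M.
  rewrite /M (bigD1 i) //= (bigD1 j) //= -addrA lerDl addr_ge0 //.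
    by apply: sumr_ge0.
  by apply: sumr_ge0 => *; apply: sumr_ge0.
rewrite lerMn2r (le_trans gM) ?orbT // ler_peMl //.
exact: le_trans (normr_ge0 _) gM.
Qed.

(** * Closures and interiors under continuous injections *)

Lemma closure_homeomorphism (T U : topologicalType) (f : T -> U) (g : U -> T) :
  cancel f g -> cancel g f -> continuous f -> continuous g ->
  forall D : set T, closure (f @` D) = f @` closure D.
Proof.
move=> fK gK cf cg D; apply/seteqP; split.
  have imE A : f @` A = g @^-1` A.
    apply/seteqP; split=> [_ [x Ax <-]|y Ay]; first by rewrite /= fK.
    by exists (g y); rewrite ?gK.
  rewrite closureE; apply: smallest_sub; last exact/image_subset/subset_closure.
  rewrite imE; apply: preimage_closed; last exact: closed_closure.
  by move=> y _; exact: cg.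
move=> _ [x Dx <-].
suff: closure D `<=` f @^-1` closure (f @` D) by apply.
rewrite [X in X `<=` _]closureE; apply: smallest_sub.
  by apply: preimage_closed; [move=> y _; exact: cf|exact: closed_closure].
by move=> y Dy; apply: subset_closure; exists y.
Qed.

Lemma interior_injective_image (T U : topologicalType) (f : T -> U)
    (D : set T) (x : T) :
  injective f -> continuous f -> (f @` D)° (f x) -> D° x.
Proof.
move=> finj cf /cf fD.
apply: (@filterS _ (nbhs x) _ (f @^-1` (f @` D))) => [y [z Dz /finj <-]|].
  exact: Dz.
exact: fD.
Qed.

Lemma piecewise_linear_continuous (R : realType) (T : topologicalType)
    (f g : T -> R) (a b : R) :
  continuous f -> continuous g ->
  continuous (fun t => f t + (a * Num.max (g t) 0 - b * Num.max (- g t) 0)).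
Proof.
move=> cf cg t.
have cmax (h : T -> R^o) : {for t, continuous h} ->
    {for t, continuous (fun t => Num.max (h t) 0)}.
  move=> ch; apply: (@continuous_max R _ h (fun=> 0)); first exact: ch.
  exact: cst_continuous.
apply: cvgD; first exact: cf.
apply: cvgB; apply: cvgM.
- exact: cvg_cst.
- by apply: cmax; exact: cg.
- exact: cvg_cst.
- by apply: cmax; apply: cvgN; exact: cg.
Qed.

(** * Tropical mutations as homeomorphisms *)

Section TropicalMutation.
Variables (R : realType) (m : nat) (uf : {set 'I_m}).
Implicit Types (eps : Juf uf -> 'I_m -> int) (k : Juf uf) (u : 'rV[R]_m).

Lemma trop_mutZ eps k (a : R) u :
  0 < a -> trop_mut eps k (a *: u) = a *: trop_mut eps k u.
Proof.
move=> a0; apply/rowP => j; rewrite !mxE pmulr_rge0 //.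
by case: ifP => _; [|case: ifP => _]; ring.
Qed.

(** The pivot coordinate and the pivot row both change sign, so the second mutation takes the
    opposite branch with the same coefficient and subtracts what the first one added. *)
Lemma trop_mutK eps eps' k :
  (forall j, eps' k j = - eps k j) ->
  cancel (@trop_mut R _ _ eps k) (trop_mut eps' k).
Proof.
move=> epsN u; apply/rowP => j; rewrite !mxE eqxx epsN opprK.
case: ifP => jk; rewrite jk ?opprK // oppr_ge0.
case: (ltrgtP (u 0 (val k)) 0) => uk.
- by ring.
- by ring.
- by rewrite uk; ring.
Qed.

Lemma trop_mut_continuous eps k : continuous (@trop_mut R _ _ eps k).
Proof.
apply: row_continuous => j.
(* Positive and negative parts of the pivot coordinate replace the case split; at the pivot itself
   the two slopes [- 2] turn [u] into [- u]. *)
suff -> : (fun u : 'rV[R]_m => trop_mut eps k u 0 j) =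
    (fun u => u 0 j +
      ((if j == val k then - 2 else (pos_part (eps k j))%:~R) *
         Num.max (u 0 (val k)) 0 -
       (if j == val k then - 2 else (pos_part (- eps k j))%:~R) *
         Num.max (- u 0 (val k)) 0)).
  by apply: piecewise_linear_continuous; exact: coord_continuous.
apply/funext => u; rewrite mxE; case: eqP => [->|_].
  case: (ltrgtP (u 0 (val k)) 0) => uk.
  - by rewrite max_l ?oppr_ge0 ?ltW //; ring.
  - by rewrite max_r ?oppr_le0 ?ltW //; ring.
  - by rewrite uk oppr0 maxxx; ring.
case: (ltrgtP (u 0 (val k)) 0) => uk.
- by rewrite max_l ?oppr_ge0 ?ltW //; ring.
- by rewrite max_r ?oppr_le0 ?ltW //; ring.
- by rewrite uk oppr0 maxxx; ring.
Qed.

Lemma mutate_exch_pivot eps k j : mutate_exch k eps k j = - eps k j.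
Proof. by rewrite /mutate_exch eqxx. Qed.

Lemma slopes_trop_mut eps k (S : set (R * 'rV[R]_m)) :
  slopes [set trop_mut_hat eps k z | z in S] = trop_mut eps k @` slopes S.
Proof.
apply/seteqP; split.
  move=> _ [n [_ [n0 [[a x] Sx [aE <-]] ->]]]; subst a.
  exists (n%:R^-1 *: x); first by exists n, x.
  by rewrite trop_mutZ // invr_gt0 ltr0n.
move=> _ [_ [n [x [n0 Sx ->]]] <-].
exists n, (trop_mut eps k x); split=> //; first by exists (n%:R, x).
by rewrite trop_mutZ // invr_gt0 ltr0n.
Qed.

Lemma closure_slopes_trop_mut eps k (S : set (R * 'rV[R]_m)) :
  closure (slopes [set trop_mut_hat eps k z | z in S]) =
  trop_mut eps k @` closure (slopes S).
Proof.
have epsN := mutate_exch_pivot eps k.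
rewrite slopes_trop_mut.
apply: (@closure_homeomorphism _ _ _ (trop_mut (mutate_exch k eps) k)).
- exact: trop_mutK.
- by apply: trop_mutK => j; rewrite epsN opprK.
- exact: trop_mut_continuous.
- exact: trop_mut_continuous.
Qed.

Lemma interior_trop_mut eps k (D : set 'rV[R]_m) u :
  (trop_mut eps k @` D)° (trop_mut eps k u) <-> D° u.
Proof.
have epsN := mutate_exch_pivot eps k.
have fK := trop_mutK epsN; split.
  exact: (interior_injective_image (can_inj fK) (@trop_mut_continuous eps k)).
have gK : cancel (@trop_mut R _ _ (mutate_exch k eps) k) (trop_mut eps k).
  by apply: trop_mutK => j; rewrite epsN opprK.
(* The converse applies the same argument to the inverse mutation, [u] being the image of
   [trop_mut eps k u]. *)
rewrite -{1}(fK u) => Du.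
apply: (interior_injective_image (can_inj gK)).
  exact: trop_mut_continuous.
apply: (@filterS _ (nbhs _) _ D) Du => v Dv /=.
by exists (trop_mut eps k v); rewrite ?fK //; exists v.
Qed.

Lemma trop_mut_fixed_pivot eps k u : trop_mut eps k u = u -> u 0 (val k) = 0.
Proof. by move=> /rowP /(_ (val k)); rewrite mxE eqxx; lra. Qed.

Lemma trop_mut_pivot0 eps k u : u 0 (val k) = 0 -> trop_mut eps k u = u.
Proof.
move=> uk; apply/rowP => j; rewrite mxE uk lexx.
by case: eqP => [->|_]; rewrite ?uk ?oppr0 ?mulr0 ?addr0.
Qed.

End TropicalMutation.

(** * Finiteness of bounded sets of rational points *)

Lemma finite_uniform_bound (T : Type) (P : set T) (Q : T -> nat -> Prop) :
  finite_set P -> (forall p a b, (a <= b)%N -> Q p a -> Q p b) ->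
  (forall p, P p -> exists n, Q p n) -> exists n, forall p, P p -> Q p n.
Proof.
move=> finP Qmono Qex.
have [f fQ] : {f : T -> nat & forall p, P p -> Q p (f p)}.
  apply: (@choice _ _ (fun p n => P p -> Q p n)) => p.
  have [/Qex [n Qn]|nP] := pselect (P p); first by exists n.
  by exists 0%N.
have /finite_seqP[s fPs] := finite_image f finP.
exists (\max_(n <- s) n)%N => p Pp; apply: Qmono (fQ _ Pp).
apply: (leq_bigmax_seq (F := id)) => //.
by have : [set` s] (f p) by rewrite -fPs; exists p.
Qed.

Lemma finite_bounded_int_vec (m M : nat) :
  finite_set [set a : 'rV[int]_m | forall j, (`|a 0%R j| <= M)%N].
Proof.
(* Entries between [- M] and [M] are shifted by [M] into the [M + M + 1] ordinals. *)
pose f (w : 'rV['I_(M + M).+1]_m) : 'rV[int]_m := \row_j ((w 0 j)%:Z - M%:Z).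
apply: (@sub_finite_set _ _ (f @` setT)); last first.
  by apply: finite_image; exact: finite_finset.
move=> a aM; exists (\row_j inord `|(a 0 j + M%:Z)%R|%N) => //.
apply/rowP => j; rewrite !mxE; have := aM j => {}aM.
by rewrite inordK; lia.
Qed.

Lemma finite_bounded_rational (R : realType) (m d : nat) (M : R)
    (P : set 'rV[R]_m) :
  (0 < d)%N -> (forall p, P p -> forall j, `|p 0 j| <= M) ->
  (forall p, P p -> exists a : 'rV[int]_m, d%:R *: p = int_vec R a) ->
  finite_set P.
Proof.
move=> d0 PM Pd.
have dR : d%:R != 0 :> R by rewrite pnatr_eq0 -lt0n.
have [N MN] : exists N : nat, d%:R * M <= N%:R.
  exists (Num.bound `|d%:R * M|).
  exact: le_trans (ler_norm _) (ltW (archi_boundP (normr_ge0 _))).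
apply: (@sub_finite_set _ _ ((fun a => d%:R^-1 *: int_vec R a) @`
    [set a : 'rV[int]_m | forall j, (`|a 0%R j| <= N)%N])); last first.
  by apply: finite_image; exact: finite_bounded_int_vec.
move=> p Pp; have [a pa] := Pd p Pp.
exists a; last by rewrite -pa scalerA mulVf // scale1r.
move=> j; rewrite -(ler_nat R) natr_absz.
have /rowP /(_ j) := pa; rewrite !mxE intr_norm => <-.
rewrite normrM normr_nat; apply: le_trans MN.
by apply: ler_wpM2l; [exact: ler0n|exact: PM].
Qed.

(** * Gradients of nonnegative affine forms *)

(** The bound is uniform in [w]: it depends only on the value [c] at [p] and on the radius of a ball
    around [p] inside [D]. *)
Lemma gradient_bound (R : realType) (m : nat) (D : set 'rV[R]_m)
    (p : 'rV[R]_m) (c : R) :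
  D° p -> exists n : nat, forall w : 'cV[R]_m,
    (forall u, D u -> 0 <= c + ((u - p) *m w) 0 0) ->
    forall i, `|w i 0| <= n%:R.
Proof.
move=> /nbhs_ballP [e /= e0 pD].
have e2 : 0 < e / 2 by rewrite divr_gt0.
exists (Num.bound `|c / (e / 2)|) => w wD i.
suff we : `|w i 0| <= c / (e / 2).
  apply: le_trans we _.
  exact: le_trans (ler_norm _) (ltW (archi_boundP (normr_ge0 _))).
rewrite ler_pdivlMr //.
(* Test the inequality at a point moved from [p] against the gradient. *)
pose v : 'rV[R]_m := - (Num.sg (w i 0) * (e / 2)) *: delta_mx 0 i.
have vw : (v *m w) 0 0 = - (`|w i 0| * (e / 2)).
  rewrite -scalemxAl mxE -rowE mxE [in RHS]normrEsg; ring.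
have := wD (v + p); rewrite addrK vw subr_ge0; apply.
apply: pD; split=> // i' j.
rewrite (ord1 i') /ball /= mxE opprD addrC subrK normrN.
rewrite !mxE normrM normrN normrM normr_sg (gtr0_norm e2).
have eh : e / 2 < e by rewrite ltr_pdivrMr // ltr_pMr // ltr1n.
case: (_ && _); last by rewrite normr0 mulr0.
by rewrite normr1 mulr1; case: eqP; rewrite ?mul0r ?mul1r.
Qed.

Lemma linear_form_continuous (R : realType) (T : topologicalType) (m : nat)
    (f : 'I_m -> T -> R) (a : 'I_m -> R) (c : R) :
  (forall i, continuous (f i)) -> continuous (fun t => \sum_i f i t * a i + c).
Proof.
move=> cf t; apply: cvgD; last exact: cvg_cst.
apply: cvg_big => [|i _]; first exact: add_continuous.
by apply: cvgMr_tmp; exact: cf.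
Qed.

Lemma affine_continuous (R : realType) (m n : nat) (A : 'M[R]_(m, n))
    (b : 'rV[R]_n) :
  continuous (fun u : 'rV[R]_m => u *m A + b).
Proof.
apply: row_continuous => j; under eq_fun do rewrite mxE mxE.
by apply: linear_form_continuous => i; exact: coord_continuous.
Qed.

Lemma int_affine_inverse (R : realType) (m : nat) (A : 'M[int]_m)
    (b : 'rV[int]_m) :
  A \in unitmx ->
  cancel (fun u : 'rV[R]_m => u *m map_mx intr A + int_vec R b)
         (fun u => (u - int_vec R b) *m map_mx intr (invmx A)).
Proof.
by move=> Au u; rewrite addrK -mulmxA -map_mxM mulmxV // map_mx1 mulmx1.
Qed.

Lemma affine_class_bound (R : realType) (m d : nat) (D : set 'rV[R]_m) (M : R)
    (u0 : 'rV[R]_m) (a0 : 'rV[int]_m) (r s : 'I_m) :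
  (forall u, D u -> forall j, `|u 0 j| <= M) ->
  (0 < d)%N -> d%:R *: u0 = int_vec R a0 -> u0 0 r = 0 ->
  exists B : nat, forall D', affine_class D D' -> D'° u0 ->
    (forall u, D' u -> 0 <= u 0 s) ->
    forall j : nat, (forall u, D' u -> 0 <= u 0 s + j%:R * u 0 r) -> (j <= B)%N.
Proof.
move=> DM d0 u0a u0r.
pose P := [set p | D° p /\ exists a : 'rV[int]_m, d%:R *: p = int_vec R a].
have finP : finite_set P.
  apply: (@finite_bounded_rational R m d M) => // [p|p [] //].
  by move=> [/interior_subset Dp _]; exact: DM.
have [n Pn] : exists n : nat, forall p, P p -> forall w : 'cV[R]_m,
    (forall u, D u -> 0 <= u0 0 s + ((u - p) *m w) 0 0) ->
    forall i, `|w i 0| <= n%:R.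
  apply: (@finite_uniform_bound _ P (fun p n => forall w : 'cV[R]_m,
    (forall u, D u -> 0 <= u0 0 s + ((u - p) *m w) 0 0) ->
    forall i, `|w i 0| <= n%:R)) => //.
    move=> p a b ab pa w wD i; apply: le_trans (pa w wD i) _.
    by rewrite ler_nat.
  by move=> p [Dp _]; exact: gradient_bound Dp.
exists (n + n)%N => _ [A [b [Au ->]]] u0D Ds j Djr.
pose F (u : 'rV[R]_m) := u *m map_mx intr A + int_vec R b.
have FK := int_affine_inverse (R := R) b Au.
have [p Dp Fp] := interior_subset u0D.
have Pp : P p.
  split.
    apply: (interior_injective_image (f := F) (can_inj FK)).
      exact: affine_continuous.
    by rewrite /F Fp.
  (* The inverse of [A] is integral, so the preimage [p] of [u0] keeps the denominator [d]. *)
  exists ((a0 - b *+ d) *m invmx A).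
  rewrite /int_vec map_mxM map_mxB -/(int_vec R a0) -u0a -(FK p) /= Fp.
  rewrite scalemxAl scalerBr; congr ((_ - _) *m _).
  by rewrite raddfMn scaler_nat.
(* [w i] is the gradient of the pullback of [u_s + i u_r] along [F]; it is the
   difference [w j - w 0] that is divisible by [j]. *)
pose w (i : nat) : 'cV[R]_m := \col_k ((A k s)%:~R + i%:R * (A k r)%:~R).
(* As [u0 0 r = 0], all these forms take the same value [u0 0 s] at [p], so one bound [n] serves
   every [i]. *)
have wE (i : nat) u :
    u0 0 s + ((u - p) *m w i) 0 0 = F u 0 s + i%:R * F u 0 r.
  have FE k : F u 0 k = u0 0 k + ((u - p) *m map_mx intr A) 0 k.
    rewrite -Fp mulmxBl /F !mxE; ring.
  rewrite !FE u0r add0r -addrA; congr (_ + _).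
  rewrite !mxE mulr_sumr -big_split; apply: eq_bigr => k _ /=.
  by rewrite !mxE; ring.
have wn i k : (forall u, D u -> 0 <= F u 0 s + i%:R * F u 0 r) ->
    `|w i k 0| <= n%:R.
  by move=> Di; apply: (Pn p Pp) => u Du; rewrite wE; exact: Di.
(* A column of an invertible matrix is nonzero; its nonzero integer entry has absolute value at
   least 1, whence [j] is at most [n + n]. *)
have [k Akr] : exists k, A k r != 0.
  apply: contrapT => nA.
  have /matrixP /(_ r r) := mulVmx Au; rewrite !mxE eqxx big1 // => k _.
  have [->|Akr] := eqVneq (A k r) 0; first by rewrite mulr0.
  by case: nA; exists k.
have w0 : `|w 0%N k 0| <= n%:R.
  by apply: wn => u Du; rewrite mul0r addr0; apply: Ds; exists u.
have wj : `|w j k 0| <= n%:R by apply: wn => u Du; apply: Djr; exists u.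
have : `|j%:R * (A k r)%:~R| <= n%:R + n%:R :> R.
  have -> : j%:R * (A k r)%:~R = w j k 0 - w 0%N k 0 :> R.
    by rewrite !mxE; ring.
  by apply: le_trans (ler_normB _ _) _; exact: lerD.
rewrite normrM normr_nat -natrD -intr_norm => jA.
move: Akr; rewrite -normr_gt0 => Akr; rewrite -(ler_nat R); apply: le_trans jA.
by rewrite ler_peMr // ?ler0n // (ler_int R 1).
Qed.

(** * The fixed point and the infinitude of classes *)

Lemma common_denominator (R : realType) (m : nat) (u : 'rV[R]_m) :
  (forall j, exists q : rat, u 0 j = ratr q) ->
  exists (d : nat) (a : 'rV[int]_m), (0 < d)%N /\ d%:R *: u = int_vec R a.
Proof.
move=> /choice[q uq].
exists (\prod_j `|denq (q j)|)%N.
exists (\row_j (numq (q j) * (\prod_(i | i != j) `|denq (q i)|)%N%:Z)).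
split; first by apply: prodn_gt0 => j; rewrite absz_gt0 denq_neq0.
apply/rowP => j; rewrite !mxE uq (bigD1 j) //= natrM rmorphM /=.
rewrite mulrAC; congr (_ * _).
rewrite natr_absz gtr0_norm ?denq_gt0 // /ratr mulrC divfK //.
by rewrite intr_eq0 denq_neq0.
Qed.

Lemma affine_class_refl (R : realType) (m : nat) (D : set 'rV[R]_m) :
  affine_class D D.
Proof.
exists 1%:M, 0; split; first exact: unitmx1.
have idE u : u *m map_mx intr 1%:M + int_vec R 0 = u :> 'rV[R]_m.
  by rewrite map_mx1 mulmx1 /int_vec map_mx0 addr0.
apply/seteqP; split=> [u Du|_ [u Du <-]]; last by rewrite idE.
by exists u.
Qed.

(** If the coordinate vanished at [p], all its positive multiples would be nonnegative forms on [D]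
    with value 0 at [p], and their gradients are unbounded. *)
Lemma interior_coord_gt0 (R : realType) (m : nat) (D : set 'rV[R]_m)
    (p : 'rV[R]_m) (s : 'I_m) :
  D° p -> D `<=` [set u : 'rV[R]_m | 0 <= u 0 s] -> 0 < p 0 s.
Proof.
move=> Dp Ds; rewrite lt_neqAle eq_sym; apply/andP; split; last first.
  exact: (Ds p (interior_subset Dp)).
apply/eqP => ps; have [n nP] := gradient_bound 0 Dp.
have wD (u : 'rV[R]_m) :
    D u -> 0 <= 0 + ((u - p) *m (n.+1%:R *: delta_mx s 0 : 'cV[R]_m)) 0 0.
  move=> /Ds us.
  by rewrite add0r -scalemxAr -colE !mxE ps subr0 mulr_ge0.
by have := nP _ wD s; rewrite !mxE !eqxx mulr1 normr_nat ler_nat ltnn.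
Qed.

Theorem theorem4p14 (R : realType) (m : nat)
    (X : projVariety R) (hX : has_dim X m)
    (L : lineBundle X) (hLgg : globally_generated L) (hLbig : big_bundle m L)
    (uf : {set 'I_m}) (K : fieldType) (iota : {rmorphism R[i] -> K})
    (tinit : seed uf K) (htinit : initial_seed iota tinit)
    (S : seed uf K -> set (R * 'rV[R]_m)) (Delta : seed uf K -> set 'rV[R]_m)
    (hNO : forall t, seeds tinit t -> is_newton_okounkov L (S t) (Delta t))
    (horigin : forall t, seeds tinit t -> Delta t 0)
    (hfg : forall t, seeds tinit t -> finitely_generated (S t))
    (hsat : forall t, seeds tinit t -> saturated (S t))
    (htrop : tropical_cluster_structure tinit S)
    (t0 : seed uf K) (ht0 : seeds tinit t0)
    (u0 : 'rV[R]_m) (hu0_int : (Delta t0)° u0)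
    (hu0_rat : forall j, exists q : rat, u0 0 j = ratr q)
    (hu0_fixed : forall ks : seq (Juf uf), trop_mut_seq t0 ks u0 = u0)
    (tl : nat -> seed uf K) (htl : forall l, seeds tinit (tl l))
    (r : Juf uf) (s : 'I_m)
    (hmult : ((exch (tl l) r s)%:~R : R) @[l --> \oo] --> -oo)
    (hnonneg : forall t, seeds tinit t ->
       Delta t `<=` [set u : 'rV[R]_m | 0 <= u 0 s]) :
  infinite_set [set affine_class (Delta t) | t in [set t | seeds tinit t]].
Proof.
have SD t : seeds tinit t -> forall z w, S t z -> S t w -> S t (z + w).
  by move=> ?; apply: finitely_generatedD; exact: hfg.
have DE t : seeds tinit t -> Delta t = closure (slopes (S t)).
  move=> ht; have [le [v [h [_ _ _ _ [SE ->]]]]] := hNO _ ht.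
  rewrite SE; apply: closure_rational_combinations.
  by apply: slopes_rational_combinations; rewrite -SE; exact: SD.
have Dmut t k : seeds tinit t ->
    Delta (mutate k t) = trop_mut (exch t) k @` Delta t.
  move=> ht; rewrite !DE //; last exact: seeds_mutate.
  by rewrite htrop // closure_slopes_trop_mut.
(* One-step sequences from [t0] suffice; the conclusion involves no exchange matrix, so [u0] is then
   fixed by mutations at every seed. *)
have u0uf (k : Juf uf) : u0 0 (val k) = 0.
  exact: (trop_mut_fixed_pivot (hu0_fixed [:: k])).
have intD_mut t k : seeds tinit t ->
    (Delta (mutate k t))° u0 <-> (Delta t)° u0.
  move=> ht; rewrite Dmut //.
  by rewrite -{1}(trop_mut_pivot0 (exch t) (u0uf k)) interior_trop_mut.
(* Interiority goes back along the mutation path from [t0] to the initial seed, then forward to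
   every seed. *)
have u0_init : (Delta tinit)° u0.
  by elim: ht0 hu0_int => // t k ht IH /(intD_mut _ _ ht).
have u0D t : seeds tinit t -> (Delta t)° u0.
  by elim=> // t' k ht IH; apply/intD_mut.
have [d [a0 [d0 u0a]]] := common_denominator hu0_rat.
move=> finC.
(* Each bound is attached to a class rather than to a seed, so finitely many classes give a single
   [B] for all seeds. *)
have [B BP] : exists B : nat, forall C,
    [set affine_class (Delta t) | t in [set t | seeds tinit t]] C ->
    forall t, seeds tinit t -> C = affine_class (Delta t) ->
    forall j : nat,
      (forall u, Delta t u -> 0 <= u 0 s + j%:R * u 0 (val r)) -> (j <= B)%N.
  apply: (@finite_uniform_bound _ _ (fun C B =>
    forall t, seeds tinit t -> C = affine_class (Delta t) ->
    forall j : nat,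
      (forall u, Delta t u -> 0 <= u 0 s + j%:R * u 0 (val r)) ->
      (j <= B)%N)) => //.
    by move=> C a b ab Ca t ht tC j jt; apply: leq_trans (Ca t ht tC j jt) ab.
  move=> _ [t1 ht1 <-].
  have [M DM] : exists M, forall y, Delta t1 y -> forall j, `|y 0 j| <= M.
    rewrite DE //; apply: slopes_bounded; first exact: hfg.
    have [le [v [h [_ _ _ _ [-> _]]]]] := hNO _ ht1.
    by move=> _ [k [f [i [k0 _ _ ->]]]]; rewrite /= ler1n.
  have [B BP] := affine_class_bound s DM d0 u0a (u0uf r).
  exists B => t ht tC; apply: (BP (Delta t)); last exact: hnonneg.
    by rewrite tC; exact: affine_class_refl.
  exact: u0D.
(* The entry is pushed below [- B], so that its absolute value [j] contradicts [j <= B]. *)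
have [l _ /(_ l (leqnn l)) hl] := cvgrNy_le hmult (- B.+1%:R).
pose j := `|exch (tl l) r s|%N.
have epsE : exch (tl l) r s = - j%:Z.
  have : exch (tl l) r s <= 0.
    by rewrite -(ler_int R); apply: le_trans hl _; rewrite oppr_le0 ler0n.
  by rewrite /j; lia.
have : (j <= B)%N.
  apply: (BP (affine_class (Delta (tl l))) _ (tl l)) => //.
    by exists (tl l) => //; exact: htl.
  move=> u Du; have us := hnonneg _ (htl l) _ Du.
  (* Only [u_r < 0] needs the mutated body: on that branch its [s]-coordinate is [u_s + j u_r]. *)
  have [ur|ur] := leP 0 (u 0 (val r)).
    by rewrite addr_ge0 // mulr_ge0.
  have : Delta (mutate r (tl l)) (trop_mut (exch (tl l)) r u).
    by rewrite Dmut //; exists u.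
  move=> /(hnonneg _ (seeds_mutate r (htl l))) /=; rewrite mxE.
  (* The fixed point separates the two indices: its [r]-coordinate is zero and its [s]-coordinate is
     positive. *)
  have sr : s != val r.
    apply/eqP => sr; have := interior_coord_gt0 hu0_int (hnonneg _ ht0).
    by rewrite sr u0uf ltxx.
  rewrite (negbTE sr) [X in if X then _ else _]leNgt ur /= epsE opprK.
  by rewrite /pos_part max_l.
by move: hl; rewrite epsE rmorphN lerN2 ler_nat ltnNge => /negbTE ->.
Qed.
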